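(* Let $\mathcal A$ be a unital $C^*$-algebra and let $E,F\subseteq l^2(\mathcal A)$ be bounded sets. The measure of noncompactness $\lambda$ has the following properties: (1) $|\lambda(E)-\lambda(F)|\le d_H(E,F)$, where $d_H(E,F)=\max\{d(E,F),d(F,E)\}$ is the Hausdorff distance; (2) $\lambda(E)=\lambda(\overline E)$, where $\overline E$ is the norm closure of $E$; (3) $\lambda(E)=0$ if and only if $E$ is $\mathcal A$-precompact; (4) $\lambda(E)\le\sup_{x\in E}\|x\|$.
   Context: $l^2(\mathcal A)$ is the standard Hilbert $C^*$-module: the right $\mathcal A$-module of all sequences $x=(\xi_1,\xi_2,\dots)$ in $\mathcal A$ for which $\sum_{j}\xi_j^*\xi_j$ converges in norm, with $\mathcal A$-valued inner product $\langle x,y\rangle=\sum_j\xi_j^*\eta_j$ (for $y=(\eta_1,\eta_2,\dots)$) and norm $\|x\|=\|\langle x,x\rangle\|^{1/2}$. For sets $E,F\subseteq l^2(\mathcal A)$, $d(E,F)=\sup_{x\in E}\inf_{y\in F}\|x-y\|$. A free finitely generated submodule $M\le l^2(\mathcal A)$ is a closed $\mathcal A$-submodule isomorphic, as a Hilbert $\mathcal A$-module, to $\mathcal A^n$ for some $n\in\mathbb N$. For a bounded set $E\subseteq l^2(\mathcal A)$, $\lambda(E)$ is the greatest lower bound of all $\eta>0$ for which there is a free finitely generated submodule $M\le l^2(\mathcal A)$ with $d(E,M)<\eta$. A bounded set $E$ is $\mathcal A$-precompact if for every $\varepsilon>0$ there is a free finitely generated submodule $M\le l^2(\mathcal A)$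 with $d(E,M)<\varepsilon$. *)

(* Defs.v *)
From HB Require Import structures.
From mathcomp Require Import all_boot all_order all_algebra.
From mathcomp Require Import complex.
From mathcomp Require Import all_classical all_reals all_analysis.

Set Implicit Arguments.
Unset Strict Implicit.
Unset Printing Implicit Defensive.

Import Order.TTheory GRing.Theory Num.Theory.
Import numFieldNormedType.Exports.

Local Open Scope classical_set_scope.
Local Open Scope ring_scope.

(* The norm is a field of the mixin, and the normed structure is derived from
   it below, because Hierarchy Builder rejects a structure that joins rings with
   normed Z-modules. [algType] is unital with 1 != 0; [Num.conj] is complex
   conjugation and [Normc.normc] is the real-valued complex modulus. *)
HB.mixin Record isCStarAlgebra (R : realType) A of GRing.Algebra R[i] A := {
  cstar_norm : A -> R ;
  cstar_normD : forall a b : A,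
    cstar_norm (a + b) <= cstar_norm a + cstar_norm b ;
  cstar_normZ : forall (c : R[i]) (a : A),
    cstar_norm (c *: a) = Normc.normc c * cstar_norm a ;
  cstar_norm0_eq0 : forall a : A, cstar_norm a = 0 -> a = 0 ;
  cstar_normM : forall a b : A,
    cstar_norm (a * b) <= cstar_norm a * cstar_norm b ;
  cstar_complete : forall u : nat -> A,
    (forall e : R, 0 < e -> exists N : nat, forall m n : nat,
      (N <= m)%N -> (N <= n)%N -> cstar_norm (u m - u n) < e) ->
    exists l : A, forall e : R, 0 < e -> exists N : nat, forall n : nat,
      (N <= n)%N -> cstar_norm (u n - l) < e ;
  star : A -> A ;
  starK : forall a : A, star (star a) = a ;
  starD : forall a b : A, star (a + b) = star a + star b ;
  starZ : forall (c : R[i]) (a : A), star (c *: a) = Num.conj c *: star a ;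
  starM : forall a b : A, star (a * b) = star b * star a ;
  cstar_identity : forall a : A, cstar_norm (star a * a) = cstar_norm a ^+ 2
}.

#[short(type="cstarAlgType")]
HB.structure Definition CStarAlgebra (R : realType) :=
  {A of GRing.Algebra R[i] A & isCStarAlgebra R A}.

Section CStarNormed.
Context (R : realType) (A : cstarAlgType R).

Lemma cstar_normMn (a : A) n : cstar_norm (a *+ n) = cstar_norm a *+ n.
Proof.
rewrite -scaler_nat cstar_normZ -[RHS]mulr_natl; congr (_ * _).
rewrite -[n%:R in LHS]/((1 : Rcomplex R) *+ n) normcMn.
by rewrite Normc.normc1.
Qed.

Lemma cstar_normN (a : A) : cstar_norm (- a) = cstar_norm a.
Proof.
by rewrite -scaleN1r cstar_normZ normcN Normc.normc1 mul1r.
Qed.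

HB.instance Definition _ := Num.Zmodule_isNormed.Build R A
  (@cstar_normD R A) (@cstar_norm0_eq0 R A) cstar_normMn cstar_normN.
HB.instance Definition _ := PseudoMetric.copy A (pseudoMetric_normed A).
HB.instance Definition _ := isPointed.Build A 0.
HB.instance Definition _ := NormedZmod_PseudoMetric_eq.Build R A erefl.

End CStarNormed.

(* Supremum in [0, +oo] of a set of nonnegative extended reals: it differs from
   [ereal_sup] only on the empty set, where it is 0 instead of -oo. *)
Definition nneg_sup {R : realType} (S : set (\bar R)) : \bar R :=
  maxe 0%E (ereal_sup S).

Section StandardModule.
Context (R : realType) (A : cstarAlgType R).
Implicit Types (x y : nat -> A) (E F M : set (nat -> A)).

Definition rscale (I : Type) (x : I -> A) (a : A) : I -> A := fun i => x i * a.

Definition l2 : set (nat -> A) :=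
  [set x | cvgn (series (fun j => star (x j) * x j))].

(* The series converges for x and y in l2, by the Cauchy-Schwarz inequality;
   outside l2 the value is irrelevant. *)
Definition l2dot x y : A := limn (series (fun j => star (x j) * y j)).

Definition l2norm x : R := Num.sqrt `|l2dot x x|.

Definition l2bounded E : Prop :=
  E `<=` l2 /\ exists r : R, forall x, E x -> l2norm x <= r.

Definition l2closure E : set (nat -> A) :=
  [set x | l2 x /\
    forall e : R, 0 < e -> exists2 y, E y & l2norm (x - y) < e].

Definition l2submodule M : Prop :=
  [/\ M `<=` l2, M 0, (forall x y, M x -> M y -> M (x + y))
    & (forall x a, M x -> M (rscale x a))].

(* An isomorphism of Hilbert modules from A^n, with its inner product
   sum_i u_i^* v_i, onto M. *)
Definition hilbert_iso n (T : ('I_n -> A) -> (nat -> A)) M : Prop :=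
  [/\ (forall u v, T (u + v) = T u + T v),
      (forall u a, T (rscale u a) = rscale (T u) a),
      (forall u v, l2dot (T u) (T v) = \sum_(i < n) star (u i) * v i)
    & set_bij setT M T].

Definition free_fg M : Prop :=
  [/\ l2submodule M, l2closure M `<=` M
    & exists n, exists T : ('I_n -> A) -> (nat -> A), hilbert_iso T M].

Definition l2dist E F : \bar R :=
  nneg_sup [set ereal_inf [set (l2norm (x - y))%:E | y in F] | x in E].

Definition hausdorff_dist E F : \bar R := maxe (l2dist E F) (l2dist F E).

Definition lambda E : R :=
  inf [set eta : R | 0 < eta /\
        exists M, free_fg M /\ (l2dist E M < eta%:E)%E].

Definition A_precompact E : Prop :=
  forall e : R, 0 < e -> exists M, free_fg M /\ (l2dist E M < e%:E)%E.

End StandardModule.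

(* Main.v *)
Require Import Defs.
From mathcomp Require Import all_boot all_order all_algebra.
From mathcomp Require Import complex.
From mathcomp Require Import all_classical all_reals all_analysis.
From mathcomp Require Import ring lra.
Import Order.TTheory GRing.Theory Num.Theory.
Import numFieldNormedType.Exports.
Local Open Scope classical_set_scope.
Local Open Scope ring_scope.
Local Open Scope complex_scope.

(** The zero submodule is free of rank 0, hence it competes in the definition
    of lambda; this bounds lambda E by the largest norm in E. Precompactness
    says that every positive radius is admissible for E, which means that the
    infimum of these radii is 0. The other two parts follow from the triangle
    inequality for the excess, d(E,M) <= d(E,F) + d(F,M) ([l2dist_triangle]):
    every radius r admissible for F gives the radius r + d admissible for E
    whenever d(E,F) <= d ([lambda_le_l2dist]). Used in both directions this is
    the Hausdorff estimate, and it covers the closure because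
    d(cl E, E) = d(E, cl E) = 0.

    The analytic content is that [l2norm] is a norm: closedness of the zero
    submodule is definiteness, and the excess needs the triangle inequality.
    Both rest on two facts about C*-algebras: the norm is monotone on
    positive elements, and every x* x is positive
    ([cstar_pos_norm_mono], [cstar_pos_star_mul]). They are proved here from
    the C*-identity without spectral theory. A self-adjoint h is called
    positive when |t - h| <= t for some t > 0, a condition that is visibly
    stable under sums. A convergent iteration provides positive square roots
    ([cstar_pos_sqrt]). If k and l are commuting self-adjoint elements with
    k^2 + l^2 = c, then u = k + i l satisfies u* u = c, so |k|^2 <= c
    ([norm_commuting_sqr_le]); applied to square roots of h and c - h this says
    that 0 <= h <= c forces |h| <= c. Finally, an element y with y* y <= 0
    vanishes ([star_mul_npos_eq0]), and applying this to x (m - a), where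
    a = x* x and m = sqrt(a^2), gives a = m >= 0.

    The triangle inequality then comes from the pointwise operator inequality
    (a + b)* (a + b) <= (1 + s) a* a + (1 + 1/s) b* b, optimised over s > 0
    after taking norms of partial sums. *)

(** * The C*-norm and the square-root iteration *)

Section CStarBasics.
Context {R : realType} {A : cstarAlgType R}.
Implicit Types (a b h k x y : A) (r s t c : R).

Lemma norm_scale c a : `|c%:C *: a| = `|c| * `|a|.
Proof.
by rewrite [LHS]cstar_normZ /= expr0n /= addr0 sqrtr_sqr.
Qed.

Lemma norm_mul a b : `|a * b| <= `|a| * `|b|.
Proof. exact: cstar_normM. Qed.

Lemma norm_star_mul a : `|star a * a| = `|a| ^+ 2.
Proof. exact: cstar_identity. Qed.

Lemma star0 : star (0 : A) = 0.
Proof. by rewrite -(scale0r (0 : A)) starZ conjC0 !scale0r. Qed.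

Lemma starN a : star (- a) = - star a.
Proof. by apply/eqP; rewrite -addr_eq0 -starD addNr star0. Qed.

Lemma starB a b : star (a - b) = star a - star b.
Proof. by rewrite starD starN. Qed.

Lemma star1 : star (1 : A) = 1.
Proof. by have := starM (star (1 : A)) 1; rewrite starK !mulr1 starK. Qed.

Lemma star_scale c a : star (c%:C *: a) = c%:C *: star a.
Proof.
rewrite starZ; congr (_ *: _); exact: conjc_real.
Qed.

Lemma star_scale_i a : star (('i : R[i]) *: a) = - (('i : R[i]) *: star a).
Proof.
rewrite starZ -scaleNr; congr (_ *: _).
by apply/eqP; rewrite eq_complex /= oppr0 !eqxx.
Qed.

(** [|a|^2 = |a* a| <= |a*| |a|] gives one inequality; the involution gives
    the other. *)
Lemma norm_star a : `|star a| = `|a|.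
Proof.
have le b : `|b| <= `|star b|.
  have [->|b0] := eqVneq b 0; first by rewrite star0.
  rewrite -(@ler_pM2r _ `|b|) ?normr_gt0//.
  by rewrite -expr2 -norm_star_mul norm_mul.
by apply/eqP; rewrite eq_le le -{2}(starK a) le.
Qed.

Lemma norm1 : `|1 : A| = 1.
Proof.
have := norm_star_mul 1; rewrite star1 mulr1 expr2 => /esym/eqP.
rewrite -subr_eq0 -{3}(mulr1 `|1 : A|) -mulrBr mulf_eq0 normr_eq0 oner_eq0 /=.
by rewrite subr_eq0 => /eqP.
Qed.

Lemma norm_scale1 c : `|c%:C *: (1 : A)| = `|c|.
Proof. by rewrite norm_scale norm1 mulr1. Qed.

Lemma norm_sqr_sa h : star h = h -> `|h * h| = `|h| ^+ 2.
Proof. by move=> hs; rewrite -norm_star_mul hs. Qed.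

Lemma eq_of_dist_le a b c : 0 <= c ->
  (forall e : R, 0 < e -> `|a - b| <= c * e) -> a = b.
Proof.
move=> c0 H; apply/eqP; rewrite -subr_eq0 -normr_le0.
apply/ler_addgt0Pr => e e0; rewrite add0r.
have c1 : 0 < c + 1 by lra.
apply: (le_trans (H (e / (c + 1)) (divr_gt0 e0 c1))).
rewrite mulrCA ger_pMr// ler_pdivrMr//; lra.
Qed.

(** A fixed point of [y |-> (x + y^2) / 2] satisfies [(1 - y)^2 = 1 - x], so
    the limit of the iteration gives a square root of [1 - x]. Each step is dominated in norm by the step of the
    same iteration run from the scalar [1], which is monotone and bounded by
    [1]; this yields convergence for every [x] of norm at most [1], the
    boundary case included. *)
Fixpoint sqrt_iter (x : A) (n : nat) : A :=
  if n is m.+1 then (2^-1)%:C *: (x + sqrt_iter x m * sqrt_iter x m) else 0.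

Fixpoint sqrt_bound (n : nat) : R :=
  if n is m.+1 then 2^-1 * (1 + sqrt_bound m ^+ 2) else 0.

Lemma sqrt_bound01 n : 0 <= sqrt_bound n <= 1.
Proof. elim: n => [|n /andP[IH1 IH2]] /=; [lra|nra]. Qed.

Lemma sqrt_bound_incr n : sqrt_bound n <= sqrt_bound n.+1.
Proof. move: (sqrt_bound01 n) => /=; nra. Qed.

Lemma sqrt_bound_homo m n : (m <= n)%N -> sqrt_bound m <= sqrt_bound n.
Proof.
exact: (@homo_leq _ _ (fun u v => u <= v) (@lexx _ _) (@le_trans _ _)
  sqrt_bound_incr).
Qed.

Lemma norm_sub_sqr_le a b r : `|a| <= r -> `|b| <= r ->
  `|a * a - b * b| <= 2 * r * `|a - b|.
Proof.
move=> ar br.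
have -> : a * a - b * b = a * (a - b) + (a - b) * b.
  by rewrite mulrBr mulrBl addrA subrK.
apply: (le_trans (ler_normD _ _)).
have := norm_mul a (a - b); have := norm_mul (a - b) b.
have : `|a| * `|a - b| <= r * `|a - b| by rewrite ler_wpM2r.
have : `|a - b| * `|b| <= r * `|a - b| by rewrite mulrC ler_wpM2r.
lra.
Qed.

(** The difference of consecutive steps factors through
    [a^2 - b^2 = a (a - b) + (a - b) b], which needs no commutation, and the
    scalar bounds satisfy the same identity. *)
Lemma sqrt_iter_step x n : `|x| <= 1 ->
  `|sqrt_iter x n| <= sqrt_bound n /\
  `|sqrt_iter x n.+1 - sqrt_iter x n| <= sqrt_bound n.+1 - sqrt_bound n.
Proof.
move=> x1; elim: n => [|n [IH1 IH2]].
  rewrite /= normr0 !mulr0 subr0 norm_scale addr0 ger0_norm ?invr_ge0//; split=> //.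
  lra.
set y' := sqrt_iter x n.+1 in IH2 *; set y := sqrt_iter x n in IH1 IH2 *.
set q' := sqrt_bound n.+1 in IH2 *; set q := sqrt_bound n in IH1 IH2 *.
have q01 := sqrt_bound01 n; have q'01 := sqrt_bound01 n.+1.
rewrite -/q in q01; rewrite -/q' in q'01.
have yq' : `|y'| <= q'.
  have -> : y' = y + (y' - y) by rewrite addrC subrK.
  by apply: (le_trans (ler_normD _ _)); lra.
split=> //.
have -> : sqrt_iter x n.+2 - y' = (2^-1)%:C *: (y' * (y' - y) + (y' - y) * y).
  have {2}-> : y' = (2^-1)%:C *: (x + y * y) by [].
  rewrite [sqrt_iter x n.+2]/(_ *: (x + y' * y')) -scalerBr; congr (_ *: _).
  rewrite mulrBr mulrBl addrA subrK opprD addrA; congr (_ - _).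
  by rewrite addrAC subrr add0r.
have -> : sqrt_bound n.+2 - q' = 2^-1 * ((q' + q) * (q' - q)).
  have -> : q' = 2^-1 * (1 + q ^+ 2) by [].
  have -> : sqrt_bound n.+2 = 2^-1 * (1 + (2^-1 * (1 + q ^+ 2)) ^+ 2) by [].
  ring.
rewrite norm_scale ger0_norm ?invr_ge0// ler_pM2l ?invr_gt0//.
apply: (le_trans (ler_normD _ _)).
have h1 : `|y' * (y' - y)| <= q' * (q' - q).
  by apply: (le_trans (norm_mul _ _)); rewrite ler_pM.
have h2 : `|(y' - y) * y| <= (q' - q) * q.
  by apply: (le_trans (norm_mul _ _)); rewrite ler_pM.
lra.
Qed.

Lemma sqrt_iter_dist x m n : `|x| <= 1 -> (m <= n)%N ->
  `|sqrt_iter x n - sqrt_iter x m| <= sqrt_bound n - sqrt_bound m.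
Proof.
move=> x1 /subnK <-; elim: (n - m)%N => [|k IH]; first by rewrite !add0n !subrr normr0.
rewrite -(subrKA (sqrt_iter x (k + m))).
apply: (le_trans (ler_normD _ _)).
by have := (sqrt_iter_step x (k + m) x1).2; rewrite addSn; lra.
Qed.

Lemma sqrt_bound_cauchy (e : R) : 0 < e -> exists N : nat, forall m : nat,
  (N <= m)%N -> sqrt_bound m - sqrt_bound N < e.
Proof.
move=> e0; set S := range sqrt_bound.
have hs : has_sup S.
  split; first by exists (sqrt_bound 0), 0%N.
  by exists 1 => _ [n _ <-]; have /andP[] := sqrt_bound01 n.
have [_ [N _ <-] hN] := sup_adherent e0 hs; exists N => m _.
have : sqrt_bound m <= sup S by apply: ub_le_sup; [exact: hs.2|exists m].
rewrite -/S in hN; lra.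
Qed.

Lemma sqrt_iter_lim x : `|x| <= 1 -> exists l, forall e : R, 0 < e ->
  exists N : nat, forall n, (N <= n)%N -> `|sqrt_iter x n - l| < e.
Proof.
move=> x1; apply: cstar_complete => e e0.
have [N hN] := sqrt_bound_cauchy e e0; exists N.
have main m n : (N <= m)%N -> (m <= n)%N -> `|sqrt_iter x n - sqrt_iter x m| < e.
  move=> Nm mn; apply: (le_lt_trans (sqrt_iter_dist x m n x1 mn)).
  have := hN n (leq_trans Nm mn); have := sqrt_bound_homo N m Nm; lra.
move=> m n Nm Nn; change (`|sqrt_iter x m - sqrt_iter x n| < e).
case: (leqP m n) => mn; first by rewrite distrC main.
by rewrite main// ltnW.
Qed.

End CStarBasics.

(** * Positive elements *)

Section Positivity.
Context {R : realType} {A : cstarAlgType R}.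
Set Implicit Arguments.
Unset Strict Implicit.
Implicit Types (a b h k l p w x y : A) (r s t c : R).

(** For self-adjoint [h] the condition says that the spectrum of [h] is
    contained in [[0, 2t]]. Asking for some [t] rather than a fixed one makes
    stability under sums immediate. *)
Definition cstar_pos h : Prop :=
  star h = h /\ exists2 t : R, 0 < t & `|t%:C *: 1 - h| <= t.

Lemma scaleCD c t a : (c + t)%:C *: a = c%:C *: a + t%:C *: a.
Proof. by rewrite rmorphD scalerDl. Qed.

Lemma scaleCB c t a : (c - t)%:C *: a = c%:C *: a - t%:C *: a.
Proof. by rewrite rmorphB scalerBl. Qed.

Lemma scaleCA c t a : c%:C *: (t%:C *: a) = (c * t)%:C *: a.
Proof. by rewrite rmorphM scalerA. Qed.

Lemma scaleC1 a : (1 : R)%:C *: a = a.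
Proof. by rewrite scale1r. Qed.

Lemma comm_scale1 a c : GRing.comm a (c%:C *: 1).
Proof. by rewrite /GRing.comm -scalerAr -scalerAl mulr1 mul1r. Qed.

Lemma comm_scaler a b c : GRing.comm a b -> GRing.comm a (c%:C *: b).
Proof. by rewrite /GRing.comm -scalerAr -scalerAl => ->. Qed.

(** The limit inherits self-adjointness and the commutation relations of its
    approximants, which are polynomials in [x]. *)
Lemma sqrt_fixpoint x : `|x| <= 1 -> star x = x -> exists y,
  [/\ star y = y, `|y| <= 1, y = (2^-1)%:C *: (x + y * y) &
      forall b, GRing.comm b x -> GRing.comm b y].
Proof.
move=> x1 xs; have [y hy] := sqrt_iter_lim x x1; exists y.
have near (e : R) : 0 < e -> exists2 n,
    `|sqrt_iter x n - y| <= e & `|sqrt_iter x n.+1 - y| <= e.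
  move=> /hy[N hN]; exists N; apply: ltW; apply: hN => //.
have iter_sa n : star (sqrt_iter x n) = sqrt_iter x n.
  elim: n => [|n IH] /=; first exact: star0.
  by rewrite star_scale starD starM xs IH.
have iter_comm b n : GRing.comm b x -> GRing.comm b (sqrt_iter x n).
  move=> bx; elim: n => [|n IH] /=; first exact: commr0.
  by apply: comm_scaler; apply: commrD => //; apply: commrM.
have iter1 n : `|sqrt_iter x n| <= 1.
  by have [h _] := sqrt_iter_step x n x1;
    have /andP[_] := @sqrt_bound01 R n; exact: le_trans.
have y1 : `|y| <= 1.
  apply/ler_addgt0Pr => e /near[n hn _].
  rewrite -(subrK (sqrt_iter x n) y) addrC; apply: (le_trans (ler_normD _ _)).
  by rewrite lerD// distrC.
split=> //.
- apply: (@eq_of_dist_le _ _ _ _ 2) => // e /near[n hn _].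
  rewrite -(subrKA (sqrt_iter x n)); apply: (le_trans (ler_normD _ _)).
  rewrite -{1}(iter_sa n) -starB norm_star distrC; lra.
- apply: (@eq_of_dist_le _ _ _ _ 2) => // e /near[n hn hn1].
  rewrite -(subrKA (sqrt_iter x n.+1)); apply: (le_trans (ler_normD _ _)).
  have -> : sqrt_iter x n.+1 - (2^-1)%:C *: (x + y * y) =
    (2^-1)%:C *: (sqrt_iter x n * sqrt_iter x n - y * y).
    by rewrite /= -scalerBr opprD addrACA subrr add0r.
  rewrite norm_scale ger0_norm ?invr_ge0// distrC.
  have := norm_sub_sqr_le _ _ _ (iter1 n) y1; lra.
- move=> b bx; apply: (@eq_of_dist_le _ _ _ _ (2 * `|b|)); first by rewrite mulr_ge0.
  move=> e /near[n hn _].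
  have -> : b * y - y * b = (sqrt_iter x n - y) * b - b * (sqrt_iter x n - y).
    rewrite mulrBr mulrBl (iter_comm b n bx) opprB.
    by rewrite [RHS]addrC subrKA.
  apply: (le_trans (ler_normB _ _)).
  have := norm_mul (sqrt_iter x n - y) b; have := norm_mul b (sqrt_iter x n - y).
  have : `|sqrt_iter x n - y| * `|b| <= e * `|b| by rewrite ler_wpM2r.
  lra.
Qed.

Lemma cstar_pos_scale c h : 0 <= c -> cstar_pos h -> cstar_pos (c%:C *: h).
Proof.
move=> c0 [hs [t t0 ht]]; split; first by rewrite star_scale hs.
exists (c * t + 1); first by nra.
rewrite scaleCD addrAC -scaleCA -scalerBr; apply: (le_trans (ler_normD _ _)).
by rewrite norm_scale norm_scale1 normr1 ger0_norm// lerD// ler_wpM2l.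
Qed.

Lemma cstar_posD h k : cstar_pos h -> cstar_pos k -> cstar_pos (h + k).
Proof.
move=> [hs [t t0 ht]] [ks [s s0 hks]]; split; first by rewrite starD hs ks.
exists (t + s); first by lra.
rewrite scaleCD opprD addrACA; apply: (le_trans (ler_normD _ _)); lra.
Qed.

Lemma cstar_pos0 : cstar_pos (0 : A).
Proof. by split; [exact: star0|exists 1 => //; rewrite subr0 norm_scale1 normr1]. Qed.

Lemma cstar_pos_scale1B c h : star h = h -> `|h| <= c -> cstar_pos (c%:C *: 1 - h).
Proof.
move=> hs hc; have c0 := le_trans (normr_ge0 _) hc.
split; first by rewrite starB star_scale star1 hs.
exists (c + 1); first by lra.
rewrite scaleCD scaleC1 opprB addrC addrA subrK.
apply: (le_trans (ler_normD _ _)); rewrite norm1; lra.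
Qed.

Lemma cstar_pos_scale1 c : 0 <= c -> cstar_pos (c%:C *: (1 : A)).
Proof.
move=> c0; apply: cstar_pos_scale => //; split; first exact: star1.
by exists 1 => //; rewrite scaleC1 subrr normr0.
Qed.

(** After scaling by [1 / t], the element [1 - h / t] has norm at most [1] and
    [1 - y], for [y] the fixed point, is a square root of [h / t]. Commutation
    with the whole commutant of [h] makes roots of related elements commute. *)
Lemma cstar_pos_sqrt h : cstar_pos h -> exists k,
  [/\ cstar_pos k, k * k = h & forall b, GRing.comm b h -> GRing.comm b k].
Proof.
move=> [hs [t t0 ht]].
have x1 : `|1 - (t^-1)%:C *: h| <= 1.
  have -> : 1 - t^-1%:C *: h = t^-1%:C *: (t%:C *: 1 - h).
    by rewrite scalerBr scaleCA mulVf ?gt_eqF// scaleC1.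
  rewrite norm_scale ger0_norm ?invr_ge0 ?(ltW t0)//.
  by rewrite ler_pdivrMl ?mulr1.
have [|y [ys y1 yE ycomm]] := sqrt_fixpoint x1.
  by rewrite starB star1 star_scale hs.
exists ((Num.sqrt t)%:C *: (1 - y)); split.
- apply: cstar_pos_scale; first exact: sqrtr_ge0.
  split; first by rewrite starB star1 ys.
  by exists 1 => //; rewrite scaleC1 opprB addrC subrK.
- have E : y + y = 1 - t^-1%:C *: h + y * y.
    rewrite {1 2}yE -scaleCD (_ : 2^-1 + 2^-1 = 1 :> R) ?scaleC1//; lra.
  have sq : (1 - y) * (1 - y) = t^-1%:C *: h.
    rewrite mulrBl mul1r mulrBr mulr1 -addrA -opprD addrA.
    by rewrite E addrK opprB addrC subrK.
  rewrite -scalerAl -scalerAr sq !scaleCA -expr2 sqr_sqrtr ?(ltW t0)//.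
  by rewrite mulfV ?gt_eqF// scaleC1.
- move=> b bh; apply: comm_scaler; apply: commrB; first exact: commr1.
  apply: ycomm; apply: commrB; first exact: commr1.
  exact: comm_scaler.
Qed.

(** With [u = k + i l], commutation gives [u* u = c], hence [|u|^2 = c], and
    [k] is the real part of [u]. *)
Lemma norm_commuting_sqr_le c k l : star k = k -> star l = l -> GRing.comm k l ->
  0 <= c -> k * k + l * l = c%:C *: 1 -> `|k| ^+ 2 <= c.
Proof.
move=> ks ls kl c0 E; pose u := k + ('i : R[i]) *: l.
have us : star u = k - ('i : R[i]) *: l by rewrite starD star_scale_i ks ls.
have u2 : `|u| ^+ 2 = c.
  have ii : 'i * 'i = -1 :> R[i] by rewrite -expr2 sqr_i.
  rewrite -norm_star_mul us mulrBl !mulrDr -!scalerAr -!scalerAl.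
  rewrite scalerA ii scaleN1r kl opprD opprK addrA addrK E norm_scale1.
  by rewrite ger0_norm.
have ku : `|k| <= `|u|.
  have E2 : k + k = u + star u by rewrite us addrACA subrr addr0.
  have := ler_normD u (star u).
  by rewrite -E2 norm_star -mulr2n normrMn; lra.
by rewrite -u2 lerXn2r// nnegrE.
Qed.

(** Apply the previous bound to commuting square roots of [h] and [c - h]. *)
Lemma cstar_pos_norm_le c h : 0 <= c -> cstar_pos h -> cstar_pos (c%:C *: 1 - h) ->
  `|h| <= c.
Proof.
move=> c0 hp chp.
have [k [kp kE kcomm]] := cstar_pos_sqrt hp.
have [l [lp lE lcomm]] := cstar_pos_sqrt chp.
rewrite -kE norm_sqr_sa ?kp.1//.
apply: (norm_commuting_sqr_le kp.1 lp.1 _ c0); last by rewrite kE lE addrC subrK.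
apply/commr_sym/kcomm/commr_sym/lcomm/commrB => //; exact: comm_scale1.
Qed.

Lemma cstar_pos_norm_mono h k : cstar_pos h -> cstar_pos (k - h) -> `|h| <= `|k|.
Proof.
move=> hp khp; apply: cstar_pos_norm_le => //.
have ks : star k = k.
  by have := khp.1; rewrite starB hp.1 => /addIr.
rewrite -(subrK k (_ *: 1)) -addrA; apply: cstar_posD => //.
exact: cstar_pos_scale1B.
Qed.

(** For [c > |k^2|] the element [c - k^2] has a square root [l] commuting with
    [k]; then [k^2 + l^2 = c], so [|c - k^2| = |l|^2 <= c]. *)
Lemma cstar_pos_sqr k : star k = k -> cstar_pos (k * k).
Proof.
move=> ks; have kks : star (k * k) = k * k by rewrite starM ks.
pose c := `|k * k| + 1; have c0 : 0 < c by rewrite /c ltr_wpDl.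
split=> //; exists c => //.
have cp : cstar_pos (c%:C *: 1 - k * k) by apply: cstar_pos_scale1B => //; rewrite lerDl.
have [l [lp lE lcomm]] := cstar_pos_sqrt cp.
rewrite -lE norm_sqr_sa ?lp.1//; apply: (norm_commuting_sqr_le lp.1 ks) (ltW c0) _.
  apply/commr_sym/lcomm/commrB; first exact: comm_scale1.
  by apply: commrM.
by rewrite lE subrK.
Qed.

(** If [d = |s + w|], then [0 <= w <= d - s]. *)
Lemma cstar_pos_norm_shift s w : 0 <= s -> cstar_pos w -> s + `|w| <= `|s%:C *: 1 + w|.
Proof.
move=> s0 wp; set d := `| _ + _|.
have sws : star (s%:C *: 1 + w) = s%:C *: 1 + w by rewrite starD star_scale star1 wp.1.
have sd : s <= d.
  have : `|s%:C *: (1 : A)| <= d.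
    by apply: cstar_pos_norm_mono; [exact: cstar_pos_scale1|rewrite addrC addKr].
  by rewrite norm_scale1 ger0_norm.
rewrite -lerBrDl; apply: cstar_pos_norm_le => //; first by rewrite subr_ge0.
rewrite scaleCB -addrA -opprD; exact: cstar_pos_scale1B.
Qed.

(** Since [y* y + y y*] is twice the sum of the squares of the real and
    imaginary parts of [y], the element [w = y y*] is positive. Put
    [c = |y|^2 = |w|] and choose [t] with [|t + y* y| <= t]. The element
    [y (t + y* y) y* = t w + w^2] has norm at most [c t], while completing the
    square and positivity of [w] bound its norm below by [c t + c^2]; hence
    [c = 0]. This replaces the comparison of the spectra of [y* y] and
    [y y*]. *)
Lemma star_mul_npos_eq0 y : cstar_pos (- (star y * y)) -> y = 0.
Proof.
move=> npos.
have wp : cstar_pos (y * star y).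
  pose p := y + star y; pose q := ('i : R[i]) *: (y - star y).
  have ps : star p = p by rewrite starD starK addrC.
  have qs : star q = q.
    by rewrite star_scale_i starB starK -scalerN opprB.
  have ii : 'i * 'i = -1 :> R[i] by rewrite -expr2 sqr_i.
  have E : p * p + q * q - (star y * y + star y * y) = 2%:C *: (y * star y).
    have qq : q * q = (star y * y - star y * star y) + (y * star y - y * y).
      rewrite /q -scalerAl -scalerAr scalerA ii scaleN1r mulrBl !mulrBr !opprB.
      by [].
    have cancel (a b c d : A) :
        (a + b) + (c + d) + ((c - d) + (b - a)) - (c + c) = b + b.
      rewrite [(c - d) + _]addrC addrACA [(a + b) + _]addrC subrKA.
      by rewrite [(c + d) + _]addrACA subrr addr0 addrK.
    rewrite qq /p mulrDl !mulrDr cancel.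
    by rewrite (_ : 2 = 1 + 1)// scaleCD !scaleC1.
  have -> : y * star y = 2^-1%:C *: (2%:C *: (y * star y)).
    by rewrite scaleCA mulVf ?scaleC1// pnatr_eq0.
  apply: cstar_pos_scale; first by rewrite invr_ge0.
  by rewrite -E opprD; do 3?apply: cstar_posD => //; exact: cstar_pos_sqr.
have [_ [t t0 ht]] := npos.
set w := y * star y in wp; set c := `|y| ^+ 2.
have cw : `|w| = c by rewrite /w -{1}(starK y) norm_star_mul norm_star.
rewrite opprK in ht.
have up : `|y * (t%:C *: 1 + star y * y) * star y| <= c * t.
  apply: (le_trans (norm_mul _ _)).
  apply: (le_trans (ler_wpM2r (normr_ge0 _) (norm_mul _ _))).
  rewrite norm_star mulrAC -expr2 -/c ler_wpM2l// sqr_ge0//.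
(* t w + w^2 = (t/2 + w)^2 - t^2/4 *)
have low : c ^+ 2 + c * t <= `|y * (t%:C *: 1 + star y * y) * star y|.
  have -> : y * (t%:C *: 1 + star y * y) * star y = t%:C *: w + w * w.
    by rewrite mulrDr mulrDl -scalerAr mulr1 -scalerAl !mulrA.
  pose s := t / 2.
  have s0 : 0 <= s by rewrite /s; lra.
  have ss : star (s%:C *: 1 + w) = s%:C *: 1 + w by rewrite starD star_scale star1 wp.1.
  have sq : (s%:C *: 1 + w) * (s%:C *: 1 + w) = (s ^+ 2)%:C *: 1 + (t%:C *: w + w * w).
    rewrite mulrDl !mulrDr -!scalerAl -!scalerAr !mul1r mulr1 scaleCA -expr2.
    rewrite -!addrA; congr (_ + _); rewrite addrA -scaleCD; congr (_%:C *: _ + _).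
    by rewrite /s; field.
  have := ler_normD ((s ^+ 2)%:C *: (1 : A)) (t%:C *: w + w * w).
  rewrite -sq norm_sqr_sa// norm_scale1 ger0_norm ?sqr_ge0//.
  have := cstar_pos_norm_shift s0 wp; rewrite cw.
  have : 0 <= c by exact: sqr_ge0.
  set n := `|_ + w|; set m := `|_ + w * w|.
  move=> c0 sn nm.
  have : (s + c) ^+ 2 <= n ^+ 2 by rewrite lerXn2r// nnegrE; lra.
  have -> : t = s + s by rewrite /s; lra.
  lra.
have c2 : c ^+ 2 <= 0 by lra.
apply/eqP; rewrite -normr_eq0 -sqrf_eq0 -/c -sqrf_eq0.
by rewrite eq_le c2 sqr_ge0.
Qed.

(** With [a = x* x], [m = sqrt(a^2)] and [b = m - a], formally twice the
    negative part of [a], one has [a b = - m b]. Thus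
    [(x b)* (x b) = b a b = - (r b)^2] where [r = sqrt m], so [x b = 0], which
    kills [a b] and [m b] and therefore [b^2]. *)
Theorem cstar_pos_star_mul x : cstar_pos (star x * x).
Proof.
set a := star x * x.
have asa : star a = a by rewrite /a starM starK.
have [m [mp mE mcomm]] := cstar_pos_sqrt (cstar_pos_sqr asa).
have [r [rp rE rcomm]] := cstar_pos_sqrt mp.
have am : GRing.comm a m by apply: mcomm; apply: commrM.
have ar : GRing.comm a r by exact: rcomm.
have rm : GRing.comm r m by apply/commr_sym/rcomm.
pose b := m - a.
have bs : star b = b by rewrite starB mp.1 asa.
have rb : GRing.comm r b by apply: commrB => //; exact: commr_sym.
have ab : a * b = - (m * b).
  by rewrite -mulNr /b !mulrBr !mulNr mE am opprK addrC.
have xb : x * b = 0.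
  apply: star_mul_npos_eq0.
  have -> : - (star (x * b) * (x * b)) = (r * b) * (r * b).
    rewrite starM bs -(mulrA b (star x)) (mulrA (star x)) -/a ab mulrN opprK -rE.
    by rewrite -(mulrA r r b) (mulrA b r) rb.
  by apply: cstar_pos_sqr; rewrite starM bs rp.1 rb.
have ab0 : a * b = 0 by rewrite /a -mulrA xb mulr0.
have mb0 : m * b = 0 by apply/eqP; rewrite -oppr_eq0 -ab ab0.
have b0 : b = 0.
  apply/eqP; rewrite -normr_eq0 -sqrf_eq0 -norm_sqr_sa// {1}/b mulrBl mb0 ab0.
  by rewrite subrr normr0.
by have /eqP := b0; rewrite subr_eq0 => /eqP <-.
Qed.

End Positivity.

(** * The norm of the standard module *)

Section StandardModuleNorm.
Context {R : realType} {A : cstarAlgType R}.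
Set Implicit Arguments.
Unset Strict Implicit.
Implicit Types (x y z : nat -> A) (r s : R).

Local Notation sqseq x := (fun j => star (x j) * x j).

Lemma cstar_pos_sum (u : nat -> A) m n : (forall j, cstar_pos (u j)) ->
  cstar_pos (\sum_(m <= j < n) u j).
Proof.
by move=> up; elim/big_ind: _ => //; [exact: cstar_pos0|exact: cstar_posD].
Qed.

(** With [r = sqrt s], the defect [c] is the square
    [(r a - b / r)* (r a - b / r)]. *)
Lemma star_mulD_le s (a b : A) : 0 < s -> exists2 c : A, cstar_pos c &
  (1 + s)%:C *: (star a * a) + (1 + s^-1)%:C *: (star b * b) =
  star (a + b) * (a + b) + c.
Proof.
move=> s0; pose r := Num.sqrt s.
have r0 : r != 0 by rewrite gt_eqF ?sqrtr_gt0.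
have rr : r * r = s by rewrite -expr2 sqr_sqrtr ?ltW.
exists (star (r%:C *: a - r^-1%:C *: b) * (r%:C *: a - r^-1%:C *: b)).
  exact: cstar_pos_star_mul.
rewrite starB starD !star_scale !mulrDl !mulrDr !mulNr !mulrN.
rewrite -!scalerAl -!scalerAr !scaleCA -invfM rr mulfV// mulVf// !scaleCD !scaleC1 opprK.
set p := star a * a; set q := star b * b; set u := star a * b; set v := star b * a.
have cancel (p' q' : A) :
    p + p' + (q + q') = p + u + (v + q) + (p' - u + (- v + q')).
  rewrite [RHS]addrACA [p' - u]addrC (addrA (p + u)) addrK.
  by rewrite [in RHS](addrACA v) subrr add0r.
exact: cancel.
Qed.

Lemma norm_sqsumD_le s x y m n : 0 < s ->
  `|\sum_(m <= j < n) star ((x + y) j) * (x + y) j| <=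
  (1 + s) * `|\sum_(m <= j < n) star (x j) * x j| +
  (1 + s^-1) * `|\sum_(m <= j < n) star (y j) * y j|.
Proof.
move=> s0.
have c1 : 0 <= 1 + s by lra.
have c2 : 0 <= 1 + s^-1 by rewrite addr_ge0// invr_ge0 ltW.
rewrite -{1}(ger0_norm c1) -{1}(ger0_norm c2) -!norm_scale.
apply: (le_trans _ (ler_normD _ _)); apply: cstar_pos_norm_mono.
  by apply: cstar_pos_sum => j; exact: cstar_pos_star_mul.
rewrite !scaler_sumr -big_split -sumrB; apply: cstar_pos_sum => j /=.
have [c cp ->] := star_mulD_le (x j) (y j) s0.
by rewrite addrC addKr.
Qed.

Lemma cvgn_of_cauchy (u : nat -> A) :
  (forall e : R, 0 < e -> exists N : nat, forall m n : nat,
      (N <= m)%N -> (m <= n)%N -> `|u n - u m| < e) -> cvgn u.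
Proof.
move=> H.
have [|l hl] := @cstar_complete R A u.
  move=> e /H[N hN]; exists N => m n Nm Nn; change (`|u m - u n| < e).
  by case: (leqP m n) => mn; [rewrite distrC hN|rewrite hN// ltnW].
apply/cvg_ex; exists l; apply/cvgrPdist_lt => e /hl[N hN].
by exists N => // n /hN; rewrite distrC.
Qed.

Lemma cauchy_of_cvgn (u : nat -> A) : cvgn u ->
  forall e : R, 0 < e -> exists N : nat, forall m n : nat,
      (N <= m)%N -> (m <= n)%N -> `|u n - u m| < e.
Proof.
move=> /cvgrPdist_lt cu e e0.
have e2 : 0 < e / 2 by lra.
have [N _ hN] := cu _ e2.
exists N => m n Nm mn; rewrite -(subrKA (limn u)).
apply: (le_lt_trans (ler_normD _ _)).
have := hN m Nm; have := hN n (leq_trans Nm mn); rewrite /= distrC; lra.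
Qed.

(** The parameter [s = 1] bounds the tails of the series of [x + y] by twice
    those of [x] and [y]. *)
Lemma l2D x y : l2 x -> l2 y -> l2 (x + y).
Proof.
move=> hx hy; apply: cvgn_of_cauchy => e e0.
have e4 : 0 < e / 4 by lra.
have [N1 h1] := cauchy_of_cvgn hx e4; have [N2 h2] := cauchy_of_cvgn hy e4.
exists (maxn N1 N2) => m n; rewrite geq_max => /andP[m1 m2] mn.
have := h1 m n m1 mn; have := h2 m n m2 mn; rewrite !sub_series_geq//.
have := @norm_sqsumD_le 1 x y m n ltr01; rewrite invr1; lra.
Qed.

Lemma l2N x : l2 x -> l2 (- x).
Proof.
move=> hx; rewrite /l2 /= (_ : (fun j => _) = sqseq x)//.
by apply/funext => j; rewrite /= starN mulrNN.
Qed.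

Lemma l2B x y : l2 x -> l2 y -> l2 (x - y).
Proof. by move=> hx hy; apply: l2D => //; exact: l2N. Qed.

Lemma l2_0 : l2 (0 : nat -> A).
Proof.
apply: cvgn_of_cauchy => e e0; exists 0%N => m n _ _.
by rewrite /series /= !big1 ?subr0 ?normr0// => i _; rewrite mulr0.
Qed.

Lemma l2dot0 x : l2dot x 0 = 0.
Proof.
rewrite /l2dot (_ : series _ = fun=> 0) ?lim_cst//.
by apply/funext => n; rewrite /series /= big1// => i _; rewrite mulr0.
Qed.

Lemma l2norm0 : l2norm (0 : nat -> A) = 0.
Proof. by rewrite /l2norm l2dot0 normr0 sqrtr0. Qed.

Lemma l2norm_cvg x : l2 x ->
  (fun n => Num.sqrt `|series (sqseq x) n|) @ \oo --> l2norm x.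
Proof.
move=> hx; apply: (@cvg_comp _ _ _ (fun n => `|series (sqseq x) n|) (@Num.sqrt R)).
  by apply: cvg_norm; exact: hx.
exact: sqrt_continuous.
Qed.

Lemma l2norm_ge0 x : 0 <= l2norm x. Proof. exact: sqrtr_ge0. Qed.

Lemma l2norm_series_le x n : l2 x -> Num.sqrt `|series (sqseq x) n| <= l2norm x.
Proof.
move=> hx; rewrite -(cvg_lim _ (l2norm_cvg hx))//.
apply: limr_ge; first by apply/cvg_ex; exists (l2norm x); exact: l2norm_cvg.
exists n => // m /= nm; rewrite ler_wsqrtr//; apply: cstar_pos_norm_mono.
  by apply: cstar_pos_sum => j; exact: cstar_pos_star_mul.
rewrite sub_series_geq//.
by apply: cstar_pos_sum => j; exact: cstar_pos_star_mul.
Qed.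

Lemma l2norm_eq0 x : l2 x -> l2norm x = 0 -> x = 0.
Proof.
move=> hx x0; have s0 n : series (sqseq x) n = 0.
  apply/eqP; rewrite -normr_eq0 eq_le normr_ge0 andbT.
  by rewrite -sqrtr_eq0 eq_le sqrtr_ge0 andbT -x0 l2norm_series_le.
apply/funext => j; apply/eqP; rewrite -normr_eq0 -sqrf_eq0 -norm_star_mul.
have := s0 j.+1; rewrite seriesEnat /= big_nat_recr//=.
have := s0 j; rewrite seriesEnat /= => ->; rewrite add0r => ->.
by rewrite normr0.
Qed.

(** For [s = q / p] the bound [(1 + s) p^2 + (1 + 1/s) q^2] equals
    [(p + q)^2]. The norms are first enlarged to [P] and [Q] so that the
    quotient makes sense when one of them vanishes. *)
Lemma l2normD x y : l2 x -> l2 y -> l2norm (x + y) <= l2norm x + l2norm y.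
Proof.
move=> hx hy; rewrite -(cvg_lim _ (l2norm_cvg (l2D hx hy)))//.
apply: limr_le.
  by apply/cvg_ex; exists (l2norm (x + y)); exact: l2norm_cvg (l2D hx hy).
exists 0%N => // n _ /=.
have hp := l2norm_series_le n hx; have hq := l2norm_series_le n hy.
apply: (le_trans _ (lerD hp hq)) => {hp hq}.
set Sx := `|series (sqseq x) n|; set Sy := `|series (sqseq y) n|.
set p := Num.sqrt Sx; set q := Num.sqrt Sy.
have p0 : 0 <= p := sqrtr_ge0 _; have q0 : 0 <= q := sqrtr_ge0 _.
have pE : p ^+ 2 = Sx by rewrite sqr_sqrtr// normr_ge0.
have qE : q ^+ 2 = Sy by rewrite sqr_sqrtr// normr_ge0.
apply/ler_addgt0Pr => e e0.
pose P := p + e / 2; pose Q := q + e / 2.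
have P0 : 0 < P by rewrite /P; lra.
have Q0 : 0 < Q by rewrite /Q; lra.
have pP : p <= P by rewrite /P; lra.
have qQ : q <= Q by rewrite /Q; lra.
have -> : p + q + e = P + Q by rewrite /P /Q; lra.
have PQ0 : 0 <= P + Q by lra.
rewrite -(ger0_norm PQ0) -sqrtr_sqr ler_wsqrtr//.
apply: (le_trans (norm_sqsumD_le x y 0 n (divr_gt0 Q0 P0))).
change ((1 + Q / P) * Sx + (1 + (Q / P)^-1) * Sy <= (P + Q) ^+ 2).
rewrite -pE -qE.
have -> : (P + Q) ^+ 2 = (1 + Q / P) * P ^+ 2 + (1 + (Q / P)^-1) * Q ^+ 2.
  by field; rewrite !gt_eqF.
have QP : 0 <= Q / P by rewrite divr_ge0 ?(ltW P0) ?(ltW Q0).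
have PQ : 0 <= (Q / P)^-1 by rewrite invr_ge0.
by apply: lerD; apply: ler_wpM2l; rewrite ?addr_ge0//
  lerXn2r ?nnegrE ?(ltW P0) ?(ltW Q0).
Qed.

Lemma l2norm_triangle x y z : l2 x -> l2 y -> l2 z ->
  l2norm (x - z) <= l2norm (x - y) + l2norm (y - z).
Proof.
by move=> hx hy hz; rewrite -(subrKA y); apply: l2normD; exact: l2B.
Qed.

End StandardModuleNorm.

(** * The measure of noncompactness *)

Section NoncompactnessMeasure.
Context {R : realType} {A : cstarAlgType R}.
Set Implicit Arguments.
Unset Strict Implicit.
Implicit Types (x y z : nat -> A) (E F G M : set (nat -> A)) (r e : R).

(** The rank is [0]; closedness is the definiteness of the norm. *)
Lemma free_fg_zero : free_fg [set (0 : nat -> A)].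
Proof.
split.
- split=> //.
  + by move=> _ ->; exact: l2_0.
  + by move=> _ _ -> ->; rewrite /= addr0.
  + by move=> _ a ->; apply/funext => i; rewrite /rscale mul0r.
- move=> x [hx H]; apply: (l2norm_eq0 hx); apply/eqP.
  rewrite eq_le l2norm_ge0 andbT; apply/ler_addgt0Pr => e e0.
  by rewrite add0r; have [_ -> /ltW] := H e e0; rewrite subr0.
- exists 0%N, (fun=> 0); split => //.
  + by move=> u v; rewrite addr0.
  + by move=> u a; apply/funext => i; rewrite /rscale mul0r.
  + by move=> u v; rewrite big_ord0 l2dot0.
  + split=> //.
    * by move=> u v _ _ _; apply/funext => -[].
    * by move=> _ ->; exists (fun=> 0).
Qed.

Local Open Scope ereal_scope.

Lemma nneg_sup_le (S : set (\bar R)) (d : \bar R) : 0 <= d ->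
  (forall s, S s -> s <= d) -> nneg_sup S <= d.
Proof. by move=> d0 Sd; rewrite /nneg_sup ge_max d0 ge_ereal_sup. Qed.

Lemma le_nneg_sup (S : set (\bar R)) s : S s -> s <= nneg_sup S.
Proof. by move=> Ss; rewrite /nneg_sup le_max ereal_sup_ubound ?orbT. Qed.

Lemma l2dist_ge0 E F : 0 <= l2dist E F.
Proof. by rewrite /l2dist /nneg_sup le_max lexx. Qed.

(** The infimum over [F] need not be attained, hence the slack [e]. *)
Lemma l2dist_le E F (d : \bar R) : 0 <= d ->
  (forall x e, E x -> (0 < e)%R ->
    exists2 y, F y & (l2norm (x - y))%:E <= d + e%:E) -> l2dist E F <= d.
Proof.
move=> d0 H; apply: nneg_sup_le => // _ [x Ex <-].
apply/lee_addgt0Pr => e e0; have [y Fy] := H x e Ex e0.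
by apply: le_trans; apply: ereal_inf_lbound; exists y.
Qed.

Lemma l2dist_approx E F x r : E x -> l2dist E F < r%:E ->
  exists2 y, F y & (l2norm (x - y) < r)%R.
Proof.
move=> Ex dr.
have /ereal_inf_lt[_ [y Fy <-]] :
    ereal_inf [set (l2norm (x - y))%:E | y in F] < r%:E.
  by apply: le_lt_trans dr; apply: le_nneg_sup; exists x.
by rewrite lte_fin; exists y.
Qed.

Lemma l2dist_triangle E F G : E `<=` @l2 R A -> F `<=` @l2 R A -> G `<=` @l2 R A ->
  l2dist E G <= l2dist E F + l2dist F G.
Proof.
move=> El Fl Gl.
case EF : (l2dist E F) (l2dist_ge0 E F) => [p| |] // p0; last first.
  by rewrite addye ?leey// gt_eqF// (lt_le_trans _ (l2dist_ge0 F G)).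
case FG : (l2dist F G) (l2dist_ge0 F G) => [q| |] // q0; last by rewrite addey ?leey.
apply: l2dist_le => [|x e Ex e0]; first by rewrite adde_ge0.
have [|y Fy xy] := @l2dist_approx E F x (p + e / 2) Ex.
  by rewrite EF lte_fin; lra.
have [|z Gz yz] := @l2dist_approx F G y (q + e / 2) Fy.
  by rewrite FG lte_fin; lra.
exists z => //; rewrite -!EFinD lee_fin.
have := l2norm_triangle (El _ Ex) (Fl _ Fy) (Gl _ Gz); lra.
Qed.

Lemma l2dist_zero E : l2dist E [set 0%R : nat -> A] <= nneg_sup [set (l2norm x)%:E | x in E].
Proof.
apply: l2dist_le => [|x e Ex e0]; first by rewrite /nneg_sup le_max lexx.
exists 0%R => //; rewrite subr0.
have : (l2norm x)%:E <= nneg_sup [set (l2norm x)%:E | x in E].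
  by apply: le_nneg_sup; exists x.
by move/le_trans; apply; rewrite leeDl// lee_fin ltW.
Qed.

Lemma l2dist_closure E : l2dist (l2closure E) E <= 0.
Proof.
apply: l2dist_le => // x e [_ H] e0; have [y Ey xy] := H e e0.
by exists y; rewrite // add0e lee_fin ltW.
Qed.

Lemma l2dist_subset E F : E `<=` F -> l2dist E F <= 0.
Proof.
move=> EF; apply: l2dist_le => // x e Ex e0; exists x; first exact: EF.
by rewrite subrr l2norm0 add0e lee_fin ltW.
Qed.

Local Close Scope ereal_scope.

Local Notation radii E := [set eta : R | 0 < eta /\
  exists M, free_fg M /\ (l2dist E M < eta%:E)%E].

Lemma radii_lbound E : has_lbound (radii E).
Proof. by exists 0 => r [/ltW]. Qed.

Lemma lambda_le_radius E r : 0 < r ->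
  (exists M, free_fg M /\ (l2dist E M < r%:E)%E) -> lambda E <= r.
Proof. by move=> r0 h; apply: ge_inf; [exact: radii_lbound|split]. Qed.

Lemma radii_nonempty E : l2bounded E -> radii E !=set0.
Proof.
move=> [_ [r hr]]; exists (`|r| + 1); split; first by rewrite ltr_wpDl.
exists [set (0 : nat -> A)]; split; first exact: free_fg_zero.
apply: (@le_lt_trans _ _ `|r|%:E); last by rewrite lte_fin ltrDl.
apply: (le_trans (l2dist_zero E)); apply: nneg_sup_le; first by rewrite lee_fin.
by move=> _ [x Ex <-]; rewrite lee_fin (le_trans (hr _ Ex))// ler_norm.
Qed.

Lemma lambda_ge0 E : l2bounded E -> 0 <= lambda E.
Proof.
by move=> hE; apply: lb_le_inf; [exact: radii_nonempty|move=> r [/ltW]].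
Qed.

Lemma lambda_approx E e : l2bounded E -> lambda E < e ->
  exists M, free_fg M /\ (l2dist E M < e%:E)%E.
Proof.
move=> hE le.
have [r [r0 [M [fM dM]]] re] := inf_lt (radii_nonempty hE) le.
by exists M; split => //; apply: (lt_trans dM); rewrite lte_fin.
Qed.

(** A submodule within [lambda F + e] of [F] is within [lambda F + e + d] of
    [E]. *)
Lemma lambda_le_l2dist E F d : E `<=` @l2 R A -> l2bounded F -> 0 <= d ->
  (l2dist E F <= d%:E)%E -> lambda E <= lambda F + d.
Proof.
move=> El hF d0 EFd; apply/ler_addgt0Pr => e e0.
have [|M [fM dM]] := @lambda_approx F (lambda F + e) hF; first by rewrite ltrDl.
have l0 := lambda_ge0 hF.
apply: lambda_le_radius; first by lra.
exists M; split => //; have [[Ml _ _ _] _ _] := fM.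
apply: (le_lt_trans (l2dist_triangle El hF.1 Ml)).
rewrite addrAC [X in (_ < X%:E)%E]addrC EFinD.
by rewrite lee_ltD// ge0_fin_numE ?l2dist_ge0// (le_lt_trans EFd) ?ltry.
Qed.

Lemma l2bounded_closure E : l2bounded E -> l2bounded (l2closure E).
Proof.
move=> [El [r hr]]; split; first by move=> x [].
exists (r + 1) => x [hx /(_ 1 ltr01)[y Ey xy]].
have := l2norm_triangle hx (El _ Ey) l2_0; rewrite !subr0.
have := hr y Ey; lra.
Qed.

Lemma lambda_closure E : l2bounded E -> lambda (l2closure E) = lambda E.
Proof.
move=> hE; have hcE := l2bounded_closure hE; apply/eqP; rewrite eq_le.
rewrite -[lambda E in X in X && _]addr0 -[lambda (l2closure E) in X in _ && X]addr0.
apply/andP; split; apply: lambda_le_l2dist => //;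
  [exact: hcE.1|exact: l2dist_closure|exact: hE.1|].
apply: l2dist_subset => x Ex; split; first exact: hE.1.
by move=> e e0; exists x => //; rewrite subrr l2norm0.
Qed.

Lemma lambda_dist_le E F : l2bounded E -> l2bounded F ->
  (`|lambda E - lambda F|%:E <= hausdorff_dist E F)%E.
Proof.
move=> hE hF; rewrite /hausdorff_dist.
case D : (maxe _ _) => [d| |]; last 2 first.
- by rewrite leey.
- have : (l2dist E F <= -oo)%E by rewrite -D le_max lexx.
  by move/(le_trans (l2dist_ge0 E F)).
have EFd : (l2dist E F <= d%:E)%E by rewrite -D le_max lexx.
have FEd : (l2dist F E <= d%:E)%E by rewrite -D le_max lexx orbT.
have d0 : 0 <= d by rewrite -lee_fin; exact: le_trans (l2dist_ge0 E F) EFd.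
have := lambda_le_l2dist hE.1 hF d0 EFd.
have := lambda_le_l2dist hF.1 hE d0 FEd.
rewrite lee_fin ler_norml; lra.
Qed.

Lemma lambda_eq0 E : l2bounded E -> lambda E = 0 <-> A_precompact E.
Proof.
move=> hE; split=> [l0 e e0|H]; first by apply: lambda_approx => //; rewrite l0.
apply/eqP; rewrite eq_le lambda_ge0// andbT; apply/ler_addgt0Pr => e e0.
by rewrite add0r; apply: lambda_le_radius => //; exact: H.
Qed.

Lemma lambda_le_sup E : l2bounded E ->
  ((lambda E)%:E <= nneg_sup [set (l2norm x)%:E | x in E])%E.
Proof.
move=> hE; have := l2dist_zero E; have := l2dist_ge0 E [set (0 : nat -> A)].
case: (nneg_sup _) => [s| |]; last 2 first.
- by move=> _ _; rewrite leey.
- by move=> d0 /(le_trans d0).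
- move=> d0 ds; have s0 : 0 <= s by rewrite -lee_fin; exact: le_trans ds.
  rewrite lee_fin; apply/ler_addgt0Pr => e e0; apply: lambda_le_radius; first by lra.
  exists [set (0 : nat -> A)]; split; first exact: free_fg_zero.
  by apply: (le_lt_trans ds); rewrite lte_fin ltrDl.
Qed.

End NoncompactnessMeasure.

Theorem proposition2p5 (R : realType) (A : cstarAlgType R)
    (E F : set (nat -> A)) (hE : l2bounded E) (hF : l2bounded F) :
  [/\ (`|lambda E - lambda F|%:E <= hausdorff_dist E F)%E,
      lambda E = lambda (l2closure E),
      lambda E = 0 <-> A_precompact E
    & ((lambda E)%:E <= nneg_sup [set (l2norm x)%:E | x in E])%E].
Proof.
split.
- exact: lambda_dist_le.
- by rewrite lambda_closure.
- exact: lambda_eq0.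
- exact: lambda_le_sup.
Qed.
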